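(* Let $p\ge 0$ and $q\ge 1$ be integers and let $n:=p+q$. Then: (1) $K_{n,0}$ is not isomorphic to $K_{p,q}$ (as real algebras); (2) $K_{p,q}\cong K_{0,n}$ (as real algebras).
   Context: For integers $p,q\ge 0$ and $n:=p+q$, the commutative analogue of Clifford algebra $K_{p,q}$ is the real associative algebra with unity generated by $e_1,\dots,e_n$ subject to $e_i^2=1$ for $1\le i\le p$, $e_i^2=-1$ for $p+1\le i\le n$, and $e_ie_j=e_je_i$ for all $i,j\in\{1,\dots,n\}$. For $A=\{i_1<\cdots<i_l\}\subseteq\{1,\dots,n\}$ put $e_A:=e_{i_1}\cdots e_{i_l}$, with $e_{\{\}}:=1$; the elements $e_A$, $A\subseteq\{1,\dots,n\}$, form a basis of $K_{p,q}$ as a real vector space, so it has dimension $2^n$. *)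

(* Defs.v *)
From HB Require Import structures.
From mathcomp Require Import all_boot all_order all_algebra.
From mathcomp Require Import ring_quotient generic_quotient complex.
From mathcomp Require Import boolp reals.
From mathcomp Require Import mpoly.

Set Implicit Arguments.
Unset Strict Implicit.
Unset Printing Implicit Defensive.

Import Order.TTheory GRing.Theory Num.Theory.

Local Open Scope ring_scope.
Local Open Scope quotient_scope.

Definition alg_iso (R : nzRingType) (A B : lalgType R) : Prop :=
  exists f : {lrmorphism A -> B}, bijective f.

Section CommutativeCliffordAnalogue.

Variables (R : realType) (p q : nat).
Local Notation n := (p + q)%N.

(* The prescribed value of e_i^2.  Indices of 'I_n start at 0, so the
   generators squaring to 1 are those with i < p. *)
Definition gen_sq (i : 'I_n) : R := if (i < p)%N then 1 else - 1.

(* A commutative algebra presented by generators and relations is a quotient of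
   the polynomial ring, i.e. of the free commutative algebra: the relations
   e_i e_j = e_j e_i are built into {mpoly R[n]}, and the remaining ones
   generate the following ideal. *)
Definition rel_poly (i : 'I_n) : {mpoly R[n]} := 'X_i ^+ 2 - (gen_sq i)%:MP.

Definition rel_ideal : {pred {mpoly R[n]}} :=
  fun f => `[< exists c : 'I_n -> {mpoly R[n]},
                 f = \sum_(i < n) c i * rel_poly i >].

(* The ideal is proper: it is killed by the morphism to R[i] sending X_i to a
   square root of gen_sq i. *)
Lemma rel_ideal_closed : idealr_closed rel_ideal.
Proof.
split.
- apply/asboolP; exists (fun=> 0).
  by rewrite big1 // => i _; rewrite mul0r.
- pose h (i : 'I_n) : R[i]%C := if (i < p)%N then 1 else 'i%C.
  pose f : {rmorphism R -> R[i]%C} := real_complex R.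
  pose phi : {rmorphism {mpoly R[n]} -> R[i]%C} := mmap f h.
  apply/asboolP => -[c /(congr1 phi)].
  rewrite rmorph1 rmorph_sum big1 => [/eqP|i _]; first by rewrite oner_eq0.
  have phiX : phi 'X_i = h i by rewrite /phi /= mmapX mmap1U.
  have phiC a : phi a%:MP = f a by rewrite /phi /= mmapC.
  rewrite rmorphM rmorphB rmorphXn phiX phiC /h /gen_sq.
  case: (i < p)%N; first by rewrite expr1n rmorph1 subrr mulr0.
  by rewrite sqr_i rmorphN1 subrr mulr0.
- move=> a u v /asboolP[c ->] /asboolP[d ->]; apply/asboolP.
  exists (fun i => a * c i + d i).
  rewrite mulr_sumr -big_split /=; apply: eq_bigr => i _.
  by rewrite mulrDl mulrA.
Qed.

HB.instance Definition _ := isIdealr.Build {mpoly R[n]} rel_ideal rel_ideal_closed.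

Definition Kpq : Type := {ideal_quot rel_ideal}.

HB.instance Definition _ := GRing.ComNzRing.on Kpq.

Definition Kpq_pi : {mpoly R[n]} -> Kpq := \pi_{ideal_quot rel_ideal}.

HB.instance Definition _ :=
  GRing.RMorphism.copy Kpq_pi \pi_{ideal_quot rel_ideal}.

(* ring_quotient provides no scalar action on quotients of algebras. *)
Definition Kpq_scale (a : R) (x : Kpq) : Kpq := Kpq_pi a%:MP * x.

Fact Kpq_scaleA a b x : Kpq_scale a (Kpq_scale b x) = Kpq_scale (a * b) x.
Proof. by rewrite /Kpq_scale mpolyCM rmorphM mulrA. Qed.

Fact Kpq_scale1 : left_id 1 Kpq_scale.
Proof. by move=> x; rewrite /Kpq_scale rmorph1 mul1r. Qed.

Fact Kpq_scaleDr : right_distributive Kpq_scale +%R.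
Proof. by move=> a x y; rewrite /Kpq_scale mulrDr. Qed.

Fact Kpq_scaleDl x : {morph Kpq_scale^~ x : a b / a + b}.
Proof. by move=> a b; rewrite /Kpq_scale mpolyCD rmorphD mulrDl. Qed.

HB.instance Definition _ := GRing.Zmodule_isLmodule.Build R Kpq
  Kpq_scaleA Kpq_scale1 Kpq_scaleDr Kpq_scaleDl.

Fact Kpq_scaleAl (a : R) (x y : Kpq) : a *: (x * y) = a *: x * y.
Proof. exact: mulrA. Qed.

HB.instance Definition _ := GRing.Lmodule_isLalgebra.Build R Kpq Kpq_scaleAl.

Fact Kpq_scaleAr (a : R) (x y : Kpq) : a *: (x * y) = x * (a *: y).
Proof. exact: mulrCA. Qed.

HB.instance Definition _ := GRing.Lalgebra_isAlgebra.Build R Kpq Kpq_scaleAr.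

Definition Kpq_gen (i : 'I_n) : Kpq := Kpq_pi 'X_i.

Lemma Kpq_gen_sq i : Kpq_gen i ^+ 2 = (gen_sq i)%:A.
Proof.
rewrite /Kpq_gen -rmorphXn /= /GRing.scale /= /Kpq_scale mulr1.
apply/eqP; rewrite /Kpq_pi -Quotient.idealrBE.
apply/asboolP; exists (fun j => (j == i)%:R).
rewrite (bigD1 i) //= eqxx mul1r big1 ?addr0 // => j /negbTE ->.
by rewrite mul0r.
Qed.

End CommutativeCliffordAnalogue.

(* Main.v *)
From HB Require Import structures.
Require Import Defs.
From mathcomp Require Import all_boot all_order all_algebra.
From mathcomp Require Import reals.
From mathcomp Require Import ring_quotient generic_quotient boolp mpoly.

(** Both claims follow from the universal property of [Kpq R p q]: morphisms to
    a commutative algebra [A] correspond to choices of elements [h i] of [A] with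
    the prescribed squares ([Kpq_lift] for existence, [Kpq_lrmorphism_ext] for
    uniqueness).

    The algebra with all squares equal to 1 has a character to [R], sending every
    generator to 1, so -1 is not a square in it; but since [1 <= q], -1 is the
    square of a generator of [Kpq R p q].  An isomorphism would carry this square
    root of -1 back, and the character would make -1 a square in [R].

    For the isomorphism, fix an index [l] whose generator squares to -1 in both
    algebras, [e l] in the first and [d l] in the second.  Because the generators
    commute, multiplying one of them by a square root of -1 flips the sign of its
    square.  So [e i |-> d i * d l] for [i < p], [e i |-> d i] otherwise, respects
    the relations, and so does [d i |-> - (e i * e l)] for [i < p], [d i |-> e i]
    otherwise.  The two morphisms are mutually inverse on the generators, hence
    everywhere. *)

Set Implicit Arguments.
Unset Strict Implicit.
Unset Printing Implicit Defensive.

Import Order.TTheory GRing.Theory Num.Theory.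

Local Open Scope ring_scope.
Local Open Scope quotient_scope.

Lemma Kpq_piZ (R : realType) (p q : nat) (a : R) (P : {mpoly R[p + q]}) :
  Kpq_pi (a *: P) = a *: Kpq_pi P.
Proof. by rewrite -mul_mpolyC rmorphM. Qed.

Lemma Kpq_pi_surj (R : realType) (p q : nat) (x : Kpq R p q) :
  exists P : {mpoly R[p + q]}, x = Kpq_pi P.
Proof. by exists (repr x); rewrite /Kpq_pi reprK. Qed.

(** Universal property: evaluation of polynomials at [h] kills the relations, so
    it descends to the quotient. *)
Lemma Kpq_lift (R : realType) (p q : nat) (A : comAlgType R)
    (h : 'I_(p + q) -> A) (hsq : forall i, h i ^+ 2 = (gen_sq R i)%:A) :
  exists f : {lrmorphism Kpq R p q -> A}, forall i, f (Kpq_gen R i) = h i.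
Proof.
pose ev : {rmorphism {mpoly R[p + q]} -> A} := mmap (in_alg A) h.
have evX i : ev 'X_i = h i by rewrite /= mmapX mmap1U.
have evC a : ev a%:MP = a%:A by rewrite /= mmapC.
have ev_rel P : rel_ideal P -> ev P = 0.
  move=> /asboolP[c ->]; rewrite rmorph_sum big1 // => i _.
  by rewrite rmorphM rmorphB rmorphXn evX evC hsq subrr mulr0.
(* Evaluating a representative gives a well-defined map, since two
   representatives of a class differ by an element of the ideal. *)
pose f (x : Kpq R p q) : A := ev (repr (x : {ideal_quot (@rel_ideal R p q)})).
have f_pi P : f (Kpq_pi P) = ev P.
  apply/eqP; rewrite -subr_eq0 -rmorphB; apply/eqP/ev_rel.
  have /eqP := reprK (Kpq_pi P : {ideal_quot (@rel_ideal R p q)}).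
  by rewrite /Kpq_pi -Quotient.idealrBE.
have fB : zmod_morphism f.
  move=> x y; have [P ->] := Kpq_pi_surj x; have [Q ->] := Kpq_pi_surj y.
  by rewrite -rmorphB !f_pi rmorphB.
have fM : monoid_morphism f.
  split=> [|x y]; first by rewrite -(rmorph1 (@Kpq_pi R p q)) f_pi rmorph1.
  have [P ->] := Kpq_pi_surj x; have [Q ->] := Kpq_pi_surj y.
  by rewrite -rmorphM !f_pi rmorphM.
have fZ : scalable f.
  move=> a x; have [P ->] := Kpq_pi_surj x.
  by rewrite -Kpq_piZ !f_pi -mul_mpolyC rmorphM evC -scalerAl mul1r.
pose F : {lrmorphism Kpq R p q -> A} :=
  HB.pack f (GRing.isZmodMorphism.Build _ _ f fB)
    (GRing.isMonoidMorphism.Build _ _ f fM)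
    (GRing.isScalable.Build _ _ _ _ f fZ).
by exists F => i; rewrite /= f_pi evX.
Qed.

(** The classes of monomials are products of generators and span the algebra. *)
Lemma Kpq_lrmorphism_ext (R : realType) (p q : nat) (A : lalgType R)
    (f g : {lrmorphism Kpq R p q -> A}) :
  (forall i, f (Kpq_gen R i) = g (Kpq_gen R i)) -> f =1 g.
Proof.
move=> eq_fg x; have [P ->] := Kpq_pi_surj x.
elim/mpolyind: P => [|c m P _ _ IH]; first by rewrite !rmorph0.
rewrite rmorphD /= [LHS]rmorphD [RHS]rmorphD /=.
rewrite IH Kpq_piZ !linearZ /= mpolyXE_id !rmorph_prod /=.
congr (c *: _ + _); apply: eq_bigr => i _.
by rewrite !rmorphXn /= eq_fg.
Qed.

Theorem theorem4p2 (R : realType) (p q : nat) (hq : (1 <= q)%N) :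
  let n := (p + q)%N in
  ~ alg_iso (Kpq R n 0) (Kpq R p q) /\ alg_iso (Kpq R p q) (Kpq R 0 n).
Proof.
move=> n.
have pq_gt : (p < p + q)%N by rewrite -addn1 leq_add2l.
(* The first generator of square -1; its index exists because [1 <= q]. *)
pose l : 'I_(p + q) := Ordinal pq_gt.
have el2 : Kpq_gen R l ^+ 2 = -1.
  by rewrite Kpq_gen_sq /gen_sq /= ltnn scaleN1r.
split.
- case=> g [g' gK g'K].
  have [|chi _] := @Kpq_lift R n 0 R^o (fun=> 1).
    by move=> i; rewrite /gen_sq (leq_trans (ltn_ord i)) ?addn0 // expr1n scale1r.
  pose y := g' (Kpq_gen R l).
  have y2 : y ^+ 2 = -1.
    by apply: (can_inj gK); rewrite rmorphXn rmorphN1 /= /y g'K.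
  have := sqr_ge0 (chi y : R).
  by rewrite -[_ ^+ 2](rmorphXn chi) y2 rmorphN1 oppr_ge0 ler10.
- pose d (i : 'I_n) : Kpq R 0 n := @Kpq_gen R 0 n i.
  have d2 i : d i ^+ 2 = -1.
    by rewrite /d Kpq_gen_sq /gen_sq ltn0 scaleN1r.
  pose e (i : 'I_n) : Kpq R p q := @Kpq_gen R p q i.
  have e2 (i : 'I_n) : e i ^+ 2 = if (i < p)%N then 1 else -1.
    by rewrite /e Kpq_gen_sq /gen_sq; case: ifP; rewrite ?scale1r ?scaleN1r.
  have [|F FE] := @Kpq_lift R p q (Kpq R 0 n : comAlgType R)
      (fun i => if (i < p)%N then d i * d l else d i).
    move=> i; rewrite /gen_sq; case: ifP => _; last by rewrite d2 scaleN1r.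
    by rewrite exprMn !d2 mulrNN mulr1 scale1r.
  (* The sign makes G inverse to F: e i |-> d i * d l |-> - e i * (e l)^2. *)
  have [|G GE] := @Kpq_lift R 0 n (Kpq R p q : comAlgType R)
      (fun i => if (i < p)%N then - (e i * e l) else e i).
    move=> i; rewrite /gen_sq ltn0 scaleN1r; case: ifP => ip.
      by rewrite sqrrN exprMn !e2 ip ltnn mul1r.
    by rewrite e2 ip.
  have Fe (i : 'I_n) : F (e i) = if (i < p)%N then d i * d l else d i.
    exact: FE.
  have Gd (i : 'I_n) : G (d i) = if (i < p)%N then - (e i * e l) else e i.
    exact: GE.
  have Fl : F (e l) = d l by rewrite Fe ltnn.
  have Gl : G (d l) = e l by rewrite Gd ltnn.
  exists F; exists G.
  + apply: (@Kpq_lrmorphism_ext R p q _ (G \o F) idfun) => i /=.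
    rewrite -/(e i) Fe; case: ifP => ip; last by rewrite Gd ip.
    by rewrite rmorphM /= Gl Gd ip mulNr -mulrA -expr2 el2 mulrN1 opprK.
  + apply: (@Kpq_lrmorphism_ext R 0 n _ (F \o G) idfun) => i /=.
    rewrite -/(d i) Gd; case: ifP => ip; last by rewrite Fe ip.
    by rewrite rmorphN rmorphM /= Fl Fe ip -mulrA -expr2 d2 mulrN1 opprK.
Qed.
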